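(* Let $C$ be a nonempty closed convex subset of $X$, let $F\colon X\to Y\cup\{+\infty_Y\}$ be a proper $K$-convex mapping such that $y^*\circ F$ is lower semicontinuous for all $y^*\in Y^*$, and let $G\colon X\to Z\cup\{+\infty_Z\}$ be a proper $S$-convex and $S$-epi closed mapping. Let $A:=C\cap G^{-1}(-S)$ and let $\bar x\in A\cap\operatorname{dom}F$. Then the following statements are equivalent: $(h)$ The set $$\bigcup_{T\in\mathcal{L}_+^w(S,K)}\Big[\bigcap_{v\in I_{-S}^*(T)}\big[\operatorname{epi}_K(F+I_C+T\circ G)^*+(0_{\mathcal{L}},v)\big]\Big]$$ is closed regarding $\{(0_{\mathcal{L}},-F(\bar x))\}$. $(i)$ $\bar x$ is a weak solution of $(\mathrm{VOP})$ if and only if there exists $T\in\mathcal{L}_+^w(S,K)$ such that $$-F(\bar x)-I_{-S}^*(T)\subset(F+I_C+T\circ G)^*(0_{\mathcal{L}})+K.$$ $(j)$ $\bar x$ is a weak solution of $(\mathrm{VOP})$ if and only if there exists $T\in\mathcal{L}_+^w(S,K)$ such that $$F(x)+(T\circ G)(x)-F(\bar x)\notin T(-S)-\operatorname{int}K,\quad\forall x\in C.$$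
   Context: $X,Y,Z$ are (real) locally convex Hausdorff topological vector spaces with topological duals $X^*,Y^*,Z^*$; $K\subset Y$ is a closed, pointed, convex cone with $\operatorname{int}K\neq\emptyset$; $S\subset Z$ is a nonempty closed convex cone. Order and infinite elements: for $y_1,y_2\in Y$, $y_1<_K y_2$ means $y_1-y_2\in-\operatorname{int}K$. $Y^\bullet:=Y\cup\{-\infty_Y,+\infty_Y\}$, where $\pm\infty_Y\notin Y$ and $-\infty_Y<_K y<_K+\infty_Y$ for all $y\in Y$ (hence also $-\infty_Y<_K+\infty_Y$). Conventions: $-(+\infty_Y)=-\infty_Y$, $-(-\infty_Y)=+\infty_Y$, $(+\infty_Y)+y=y+(+\infty_Y)=+\infty_Y$ for $y\in Y\cup\{+\infty_Y\}$, $(-\infty_Y)+y=y+(-\infty_Y)=-\infty_Y$ for $y\in Y\cup\{-\infty_Y\}$. Analogous elements $\pm\infty_Z$ and conventions are used for $Z$ (ordered by $S$). Weak supremum/infimum: for $\emptyset\neq M\subset Y^\bullet$, $\operatorname{WSup}M$ is the set of $\bar v\in Y^\bullet$ such that $\bar v\not<_K v$ for all $v\in M$, and for every $\tilde v\in Y^\bullet$ with $\tilde v<_K\bar v$ there is $v\in M$ with $\tilde v<_K v$. $\operatorname{WInf}M$ is the set of $\bar v\in Y^\bullet$ such that $v\not<_K\bar v$ for all $v\in M$, and for every $\tilde v\in Y^\bullet$ with $\bar v<_K\tilde v$ there is $v\in M$ with $v<_K\tilde v$. $\operatorname{WMin}M=M\cap\operatorname{WInf}M$. $(\mathrm{VOP})$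 is the problem $\operatorname{WMin}\{F(x): x\in C,\ G(x)\in-S\}$, and $\bar x\in A$ is a weak solution of $(\mathrm{VOP})$ if $F(\bar x)\in\operatorname{WMin}F(A)$. Mappings: for $F\colon X\to Y^\bullet$, $\operatorname{dom}F=\{x\in X: F(x)\neq+\infty_Y\}$; $F$ is proper if $\operatorname{dom}F\neq\emptyset$ and $-\infty_Y\notin F(X)$; $\operatorname{epi}_KF=\{(x,y)\in X\times Y: y\in F(x)+K\}$; $F$ is $K$-convex if $\operatorname{epi}_KF$ is convex, and $K$-epi closed if it is closed. The same notions are used for $G$ with $(Z,S)$ in place of $(Y,K)$. For $y^*\in Y^*$, $(y^*\circ F)(x)=y^*(F(x))$ if $F(x)\in Y$ and $+\infty$ if $F(x)=+\infty_Y$. $\mathcal{L}(X,Y)$ is the space of continuous linear mappings $X\to Y$ with the topology of pointwise convergence; $0_{\mathcal{L}}$ is its zero element. The conjugate of $F$ is the set-valued map $F^*(L)=\operatorname{WSup}\{L(x)-F(x):x\in X\}$, $L\in\mathcal{L}(X,Y)$, and $\operatorname{epi}_KF^*=\{(L,y)\in\mathcal{L}(X,Y)\times Y: y\in F^*(L)+K\}$. For a set $D$ in $X$ (or in $Z$), $I_D(x)=0_Y$ if $x\in D$ and $I_D(x)=+\infty_Y$ otherwise; in particular, for $-S\subset Z$ and $T\in\mathcal{L}(Z,Y)$, $I_{-S}^*(T)=\operatorname{WSup}T(-S)$. For $T\in\mathcal{L}(Z,Y)$, $(T\circ G)(x)=T(G(x))$ if $G(x)\in Z$ and $+\infty_Y$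 if $G(x)=+\infty_Z$. $\mathcal{L}_+^w(S,K)=\{T\in\mathcal{L}(Z,Y): T(S)\cap(-\operatorname{int}K)=\emptyset\}$. For subsets $P,Q$ of a topological space (here $\mathcal{L}(X,Y)\times Y$), $P$ is closed regarding $Q$ if $Q\cap\operatorname{cl}P=Q\cap P$. *)

(* Defs.v *)
From HB Require Import structures.
From mathcomp Require Import all_boot all_order all_algebra.
From mathcomp Require Import all_classical all_reals all_analysis.

Set Implicit Arguments.
Unset Strict Implicit.
Unset Printing Implicit Defensive.

Import Order.TTheory GRing.Theory Num.Theory.
Import numFieldNormedType.Exports.
Local Open Scope classical_set_scope.
Local Open Scope ring_scope.

Section ContinuousLinear.
Context {R : realType}.

Definition lincont (X Y : tvsType R) : {pred X -> Y} :=
  fun f => `[< linear f /\ continuous f >].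

Lemma lincont_submod_closed (X Y : tvsType R) :
  submod_closed (@lincont X Y).
Proof.
split=> [|a f g /asboolP[lf cf] /asboolP[lg cg]]; apply/asboolP; split.
- by move=> b u v; rewrite /= scaler0 addr0.
- by move=> x; apply: (@cst_continuous _ _ (0 : Y)).
- move=> b u v; rewrite !fctE /= lf lg !scalerDr !scalerA (mulrC a b).
  by rewrite addrACA.
- move=> x.
  apply: (@continuous_comp _ _ _ (fun x => (a *: f x, g x))
    (fun z : Y * Y => z.1 + z.2)) => /=; last exact: (@add_continuous Y).
  apply: cvg_pair => /=; last exact: cg.
  apply: (@continuous_comp _ _ _ (fun x => (a, f x))
    (fun z : R^o * Y => z.1 *: z.2)) => /=; last exact: scale_continuous.
  have ca : (fun _ : X => a : R^o) @ x --> (a : R^o) by exact: cvg_cst.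
  exact: (cvg_pair ca (cf x)).
Qed.

Record clin (X Y : tvsType R) : Type :=
  Clin { clin_fun :> X -> Y ; _ : clin_fun \in @lincont X Y }.

End ContinuousLinear.

Section ContinuousLinearInstances.
Context (R : realType) (X Y : tvsType R).

HB.instance Definition _ := [isSub for @clin_fun R X Y].
HB.instance Definition _ := [Choice of clin X Y by <:].
HB.instance Definition _ :=
  GRing.SubChoice_isSubLmodule.Build R (X -> Y) (@lincont R X Y) (clin X Y)
    (GRing.submod_closed_semi (@lincont_submod_closed R X Y)).
HB.instance Definition _ := Topological.copy (clin X Y)
  (initial_topology (fun T : clin X Y => (T : X -> Y) : {ptws X -> Y})).

End ContinuousLinearInstances.

Definition cone {R : realType} {V : lmodType R} (K : set V) :=
  forall (t : R) (x : V), 0 <= t -> K x -> K (t *: x).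

Definition pointed_cone {V : zmodType} (K : set V) :=
  K `&` (-%R @` K) = [set 0].

Section Order.
Context {R : realType} {Y : tvsType R} (K : set Y).
Implicit Types (a b : \bar Y) (M : set (\bar Y)).

(* [\bar Y] is the library's disjoint union of [Y] with two elements [+oo] and
   [-oo].  Its addition and opposite extend the conventions for infinite elements
   by the value [+oo + -oo = -oo], which an [eproper] mapping never produces. *)
Definition ltK a b : Prop :=
  match a, b with
  | EFin y1, EFin y2 => (-%R @` K°) (y1 - y2)
  | EFin _, EPInf => True
  | ENInf, EFin _ => True
  | ENInf, EPInf => True
  | _, _ => False
  end.

Definition WSup M : set (\bar Y) :=
  [set w | (forall v, M v -> ~ ltK w v) /\
           (forall u, ltK u w -> exists2 v, M v & ltK u v)].

Definition WInf M : set (\bar Y) :=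
  [set w | (forall v, M v -> ~ ltK v w) /\
           (forall u, ltK w u -> exists2 v, M v & ltK v u)].

Definition WMin M : set (\bar Y) := M `&` WInf M.

Definition addK M : set (\bar Y) :=
  [set (a + k%:E)%E | a in M & k in K].

End Order.

Section Mappings.
Context {R : realType} {X Y : tvsType R}.
Implicit Types (F : X -> \bar Y) (K : set Y) (L : clin X Y).

Definition edom F : set X := [set x | F x <> +oo%E].

Definition eproper F : Prop :=
  edom F !=set0 /\ ~ range F -oo%E.

Definition epi K F : set (X * Y) :=
  [set p | addK K [set F p.1] p.2%:E].

Definition Kconvex K F : Prop := convex_set (epi K F).

Definition Kepi_closed K F : Prop := closed (epi K F).

Definition indic (Y' : tvsType R) (D : set X) : X -> \bar Y' :=
  fun x => if `[< D x >] then 0%:E else +oo%E.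

Definition conjugate K F L : set (\bar Y) :=
  WSup K [set ((L x)%:E - F x)%E | x in [set: X]].

Definition epi_conjugate K F : set (clin X Y * Y) :=
  [set p | addK K (conjugate K F p.1) p.2%:E].

(* The translate of [E] by [(0, v)] for an extended [v]; it has no point in
   [clin X Y * Y] when [v] is infinite. *)
Definition translate (E : set (clin X Y * Y)) (v : \bar Y) :
    set (clin X Y * Y) :=
  [set p | exists2 q, E q & (p.1, p.2%:E) = (q.1 + 0, (q.2%:E + v)%E)].

End Mappings.

Definition closed_regarding {T : topologicalType} (P Q : set T) : Prop :=
  Q `&` closure P = Q `&` P.

Definition Lplusw {R : realType} {Z Y : tvsType R} (S : set Z) (K : set Y) :
    set (clin Z Y) :=
  [set T | (T @` S) `&` (-%R @` K°) = set0].

Section Problem.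
Context {R : realType} {X Y Z : tvsType R}.
Variables (K : set Y) (S : set Z) (C : set X).
Variables (F : X -> \bar Y) (G : X -> \bar Z).

Definition feasible : set X :=
  C `&` G @^-1` (EFin @` (-%R @` S)).

Definition weak_solution (x : X) : Prop :=
  feasible x /\ WMin K (F @` feasible) (F x).

Definition lagrangian (T : clin Z Y) : X -> \bar Y :=
  fun x => (F x + indic Y C x + er_map T (G x))%E.

Definition indic_conj (T : clin Z Y) : set (\bar Y) :=
  conjugate K (indic Y (-%R @` S)) T.

End Problem.

(* Main.v *)
Require Import Defs.
From HB Require Import structures.
From mathcomp Require Import all_boot all_order all_algebra.
From mathcomp Require Import all_classical all_reals all_analysis.
From mathcomp Require Import ring lra.

Set Implicit Arguments.
Unset Strict Implicit.
Unset Printing Implicit Defensive.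

Import Order.TTheory GRing.Theory Num.Theory.
Import numFieldNormedType.Exports.
Local Open Scope classical_set_scope.
Local Open Scope ring_scope.

(** The heart of the theorem is that the closure of the union
    [P = \bigcup_T \bigcap_v (epi (F + I_C + T o G)^* + (0, v))] contains
    [(0, - F xbar)] exactly when [xbar] is a weak solution; this holds without
    any constraint qualification.  On the other hand, once suprema are unfolded, the
    membership of [(0, - F xbar)] in [P] itself, the inclusion in [i] and the
    non-membership in [j] are three spellings, multiplier by multiplier, of the
    relation [dominates T 0 (- F xbar)].  Such a [T] always certifies optimality,
    so the three assertions all say that a weak solution has one.

    The unfolding rests on the geometry of weak suprema.  If [M] has a finite
    point below it and is not cofinal, then on every line in the direction of an
    interior point [k0] of [K] there is a parameter at which the line
    leaves the open set [below M], and the corresponding point is in [WSup M]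
    ([WSup_line]).  Hence [WSup M + K] is the complement of [below M]
    ([addK_WSup]), and [u] lies in [below M] if and only if it is dominated by
    an element of [WSup M] ([below_WSup]).

    For [(0, - F xbar)] in [closure P] to imply optimality, fix a feasible [x].
    Every [(L, y)] in [P] satisfies [L x - F x - y \notin int K]
    ([dominates_feasible]); this condition is closed in [(L, y)], because
    evaluation at [x] is continuous, and at [(0, - F xbar)] it says that
    [F x] does not improve on [F xbar].

    Conversely, let [xbar] be a weak solution.  Separating [F(A) + int K] from
    [F xbar] gives a functional [ystar], positive on [int K], such that [xbar]
    minimises [ystar o F] over the feasible set ([scalarization]).  A closed
    convex scalar problem always has approximate multipliers: for finitely many
    [x_i] and [e > 0] there are functionals [u], [v] with [|u x_i| < e] and
    [ystar (F xbar) - e <= u x + v z + ystar (F x)] for all [x] in [C] and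
    [z] in [G x + S] ([approximate_multiplier]).  With [k0] in [int K]
    normalised by [ystar k0 = 1], the rank-one maps [T z = v z *: k0] and
    [L x = - u x *: k0] give the point [(L, e *: k0 - F xbar)] of [P], and these
    points approach [(0, - F xbar)] pointwise ([asymptotic_multiplier],
    [closure_rank1]).

    Both separations come from the Hahn-Banach theorem
    ([open_convex_separation]), proved here through maximal cones. *)

(** * Convex sets and maximal cones *)

Lemma convex_setP (R : realType) (V : lmodType R) (A : set V) :
  convex_set A <-> forall x y t, 0 <= t -> t <= 1 -> A x -> A y ->
    A (t *: x + (1 - t) *: y).
Proof.
split=> [cA x y t t0 t1 Ax Ay|cA x y t /set_mem Ax /set_mem Ay].
- by have /set_mem := cA x y (Itv01 t0 t1) (mem_set Ax) (mem_set Ay).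
- by apply/mem_set; apply: cA.
Qed.

Section Cones.
Variables (R : realType) (V : lmodType R).
Implicit Types (M U : set V).

(** Such a set is the positive cone of a partial vector order; total orders of this
    kind replace dominated functionals in the proof of the Hahn-Banach theorem. *)
Definition blunt_cone M :=
  [/\ forall x y, M x -> M y -> M (x + y),
      forall t x, 0 < t -> M x -> M (t *: x) & ~ M 0].

(** For [x] nonzero, the cone generated by [M] and [x] could only contain 0 if
    [- x] were already in [M]. *)
Lemma blunt_cone_extend M x : blunt_cone M -> x != 0 -> ~ M x -> ~ M (- x) ->
  blunt_cone [set z | exists m s,
    [/\ M m \/ m = 0, 0 <= s, (M m \/ 0 < s) & z = m + s *: x]].
Proof.
move=> [Ma Ms M0] x0 Mx MNx; split.
- move=> _ _ [m [s [Mm s0 ms ->]]] [n [t [Mn t0 nt ->]]].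
  exists (m + n), (s + t); split.
  + case: Mm => [Mm|->]; case: Mn => [Mn|->]; rewrite ?add0r ?addr0; auto.
  + exact: addr_ge0.
  + case: ms => [mM|s_gt0]; last by right; rewrite ltr_wpDr.
    case: nt => [nM|t_gt0]; last by right; rewrite ltr_wpDl.
    by left; apply: Ma.
  + by rewrite scalerDl addrACA.
- move=> t _ t0 [m [s [Mm s0 ms ->]]]; exists (t *: m), (t * s); split.
  + by case: Mm => [Mm|->]; [left; exact: Ms|right; rewrite scaler0].
  + by rewrite mulr_ge0// ltW.
  + by case: ms => [?|?]; [left; exact: Ms|right; exact: mulr_gt0].
  + by rewrite scalerDr scalerA.
- move=> [m [s [Mm s0 ms /esym/eqP]]]; rewrite addr_eq0 => /eqP mE.
  have [s_eq0|s_neq0] := eqVneq s 0.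
    move: ms mE; rewrite s_eq0 ltxx scale0r oppr0 => -[Mm' m0|//].
    by apply: M0; rewrite -m0.
  have s_gt0 : 0 < s by rewrite lt_neqAle eq_sym s_neq0.
  case: Mm => [Mm|m0].
    apply: MNx; have := Ms s^-1 m; rewrite invr_gt0 => /(_ s_gt0 Mm).
    by rewrite mE scalerN scalerA mulVf// scale1r.
  move/eqP: mE; rewrite m0 eq_sym oppr_eq0 scaler_eq0 (negbTE s_neq0).
  by rewrite (negbTE x0).
Qed.

(** Zorn: a maximal blunt cone is total, since otherwise [blunt_cone_extend] would
    enlarge it. *)
Lemma blunt_cone_maximal U : blunt_cone U ->
  exists M, [/\ blunt_cone M, U `<=` M & forall x, x != 0 -> M x \/ M (- x)].
Proof.
move=> [Ua Us U0].
(* Uniting with [U] makes the empty chain harmless. *)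
pose P := [set A | blunt_cone (A `|` U)].
have [] := @Zorn_bigcup _ P.
  move=> F FP Ft; split.
  - move=> x y Fx Fy.
    suff [A AU [Ax Ay]] : exists2 A, F A \/ A = set0 & (A `|` U) x /\ (A `|` U) y.
      case: AU => [FA|A0].
        have [/(_ x y Ax Ay) + _ _] := FP _ FA.
        by case=> [?|?]; [left; exists A|right].
      by right; move: Ax Ay; rewrite A0 set0U; exact: Ua.
    case: Fx => [[A FA Ax]|Ux]; case: Fy => [[B FB By]|Uy].
    + have [AB|BA] := Ft _ _ FA FB.
        by exists B; [left|split; left; [exact: AB|]].
      by exists A; [left|split; left; [|exact: BA]].
    + by exists A; [left|split; [left|right]].
    + by exists B; [left|split; [right|left]].
    + by exists set0; [right|split; right].
  - move=> t x t0 [[A FA Ax]|Ux]; last by right; exact: Us.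
    have [_ /(_ t x t0 (or_introl Ax)) + _] := FP _ FA.
    by case=> [?|?]; [left; exists A|right].
  - move=> [[A FA A0]|//]; have [_ _] := FP _ FA.
    by apply; left.
move=> A [PA maxA]; exists (A `|` U); split; [by []|by move=> z Uz; right|].
move=> x x0; apply: contrapT => /not_orP[Mx MNx].
have PB := blunt_cone_extend PA x0 Mx MNx.
set B := (X in blunt_cone X) in PB.
have UAB : A `|` U `<=` B.
  by move=> z Az; exists z, 0; split; rewrite ?scale0r ?addr0//; left.
have Bx : B x.
  by exists 0, 1; split; rewrite ?scale1r ?add0r//; right.
apply: (maxA B).
  split; last by move=> /(_ _ Bx) Ax; apply: Mx; left.
  by move=> z Az; apply: UAB; left.
rewrite /P/=; suff -> : B `|` U = B by [].
by apply/seteqP; split=> [z [//|Uz]|z]; [apply: UAB; right|left].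
Qed.

End Cones.

Section ConeFunctional.
Variables (R : realType) (V : lmodType R) (M : set V) (u0 : V).
Hypotheses (coneM : blunt_cone M) (Mu0 : M u0)
  (totM : forall x, x != 0 -> M x \/ M (- x))
  (unitM : forall x, exists t, M (t *: u0 - x)).

(* In the total order with positive cone [M] and order unit [u0], the functional
   sends [x] to the cut of the reals that [x] defines through [t |-> t *: u0]. *)
Let lower x := [set t : R | M (x - t *: u0)].
Let phi x : R := sup (lower x).

Let M_scale t : 0 < t -> M (t *: u0).
Proof. by case: coneM => _ Ms _ t0; exact: Ms. Qed.

Let lower_bounded x : has_sup (lower x).
Proof.
have [Ma _ M0] := coneM; split.
  have [t Mt] := unitM (- x); exists (- t).
  by rewrite /lower/= scaleNr opprK addrC; move: Mt; rewrite opprK.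
have [t Mt] := unitM x; exists t => s Ms; rewrite leNgt; apply/negP => ts.
apply: M0; have := Ma _ _ Mt (Ma _ _ Ms (M_scale (_ : 0 < s - t))).
rewrite subr_gt0 => /(_ ts); rewrite scalerBl.
suff -> : t *: u0 - x + (x - s *: u0 + (s *: u0 - t *: u0)) = 0 by [].
by rewrite !addrA !subrK subrr.
Qed.

Let phi_ge x t : M (x - t *: u0) -> t <= phi x.
Proof. by move=> Mt; apply: sup_ubound => //; case: (lower_bounded x). Qed.

Let phi_gt x t : t < phi x -> M (x - t *: u0).
Proof.
have [Ma _ _] := coneM => tphi.
have [s Ms ts] : exists2 s, lower x s & t < s.
  by apply: sup_gt => //; case: (lower_bounded x).
have := Ma _ _ Ms (M_scale (_ : 0 < s - t)).
by rewrite subr_gt0 scalerBl addrA subrK; exact.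
Qed.

Let phi_lt x t : phi x < t -> M (t *: u0 - x).
Proof.
move=> phit; have tx0 : t *: u0 - x != 0.
  apply/eqP => /subr0_eq xE; move: phit; rewrite ltNge => /negP; apply.
  apply/ler_addgt0Pr => e e0; rewrite -lerBlDr; apply: phi_ge.
  by rewrite -xE -scalerBl subKr; exact: M_scale.
by case: (totM tx0) => //; rewrite opprB => /phi_ge; rewrite leNgt phit.
Qed.

Let phi_le x t : M (t *: u0 - x) -> phi x <= t.
Proof.
have [Ma _ M0] := coneM => Mt; rewrite leNgt; apply/negP => /phi_gt Mx.
by apply: M0; have := Ma _ _ Mt Mx; rewrite addrA subrK subrr.
Qed.

(** Additivity follows from the cut being described from both sides: by totality
    [x] exceeds [t *: u0] for [t] below the supremum, and [t *: u0] exceeds [x]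
    above it. *)
Lemma total_cone_functional : exists f : V -> R^o,
  [/\ linear f, (forall x t, M (x - t *: u0) -> t <= f x) &
     forall x t, M (t *: u0 - x) -> f x <= t].
Proof.
have [Ma Ms M0] := coneM.
have phiD x y : phi (x + y) = phi x + phi y.
  apply/eqP; rewrite eq_le; apply/andP; split; apply/ler_addgt0Pr => e e0.
  - apply: phi_le.
    have phi_e z : M ((phi z + e / 2) *: u0 - z).
      by apply: phi_lt; rewrite ltrDl divr_gt0.
    have := Ma _ _ (phi_e x) (phi_e y).
    rewrite addrACA -scalerDl -opprD.
    by rewrite (_ : _ + e / 2 + _ = phi x + phi y + e)//; lra.
  - rewrite -lerBlDr; apply: phi_ge.
    have phi_e z : M (z - (phi z - e / 2) *: u0).
      by apply: phi_gt; rewrite ltrBlDr ltrDl divr_gt0.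
    have := Ma _ _ (phi_e x) (phi_e y).
    rewrite addrACA -opprD -scalerDl.
    by rewrite (_ : phi x - e / 2 + _ = phi x + phi y - e)//; lra.
have phi0 : phi 0 = 0.
  by have /eqP := phiD 0 0; rewrite addr0 -subr_eq0 opprD addNKr oppr_eq0 => /eqP.
have phiN x : phi (- x) = - phi x.
  by apply/eqP; rewrite -subr_eq0 opprK -phiD addNr phi0.
have phiZ_gt0 a x : 0 < a -> phi (a *: x) = a * phi x.
  move=> a0; apply/eqP; rewrite eq_le; apply/andP; split.
    rewrite -ler_pdivrMl//; apply/ler_addgt0Pl => e e0.
    rewrite ler_pdivrMl//; apply: phi_le.
    rewrite -scalerA -scalerBr; apply: Ms => //; apply: phi_lt.
    by rewrite ltrDr.
  rewrite -ler_pdivlMl//; apply/ler_addgt0Pl => e e0.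
  rewrite -lerBlDl ler_pdivlMl//; apply: phi_ge.
  rewrite -scalerA -scalerBr; apply: Ms => //; apply: phi_gt.
  by rewrite ltrBlDl ltrDr.
exists phi; split=> // a x y.
rewrite phiD; congr (_ + _).
have [a0|a0|->] := ltgtP a 0; last by rewrite !scale0r phi0.
- by rewrite -[in LHS](opprK a) scaleNr phiN phiZ_gt0 ?oppr_gt0// mulNr opprK.
- exact: phiZ_gt0.
Qed.

End ConeFunctional.

Lemma lincontP (R : realType) (X Y : tvsType R) (f : clin X Y) :
  linear f /\ continuous f.
Proof. by case: f => f /= /asboolP. Qed.

Section TvsConvergence.
Variables (R : realType) (V : tvsType R) (T : Type) (F : set_system T).
Context {FF : Filter F}.

Lemma tvs_cvgD (f g : T -> V) a b : f @ F --> a -> g @ F --> b ->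
  (fun x => f x + g x) @ F --> a + b.
Proof.
move=> fa gb; apply: continuous2_cvg fa gb => /=.
exact: (@add_continuous V (a, b)).
Qed.

Lemma tvs_cvgZ (f : T -> R^o) (g : T -> V) a b :
  f @ F --> (a : R^o) -> g @ F --> b -> (fun x => f x *: g x) @ F --> a *: b.
Proof.
move=> fa gb; apply: continuous2_cvg fa gb => /=.
exact: (@scale_continuous R V (a, b)).
Qed.

Lemma tvs_cvgN (f : T -> V) a : f @ F --> a -> (fun x => - f x) @ F --> - a.
Proof. by move=> fa; apply: continuous_cvg => //; exact: opp_continuous. Qed.

Lemma tvs_cvgB (f g : T -> V) a b : f @ F --> a -> g @ F --> b ->
  (fun x => f x - g x) @ F --> a - b.
Proof. by move=> fa gb; apply: tvs_cvgD => //; exact: tvs_cvgN. Qed.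

End TvsConvergence.

(** Along a line through [u] the preimage of [U] is a neighbourhood of 0. *)
Lemma open_absorbing (R : realType) (V : tvsType R) (U : set V) u x :
  open U -> U u -> exists2 e : R, 0 < e & forall s, `|s| <= e -> U (u + s *: x).
Proof.
move=> oU Uu.
have : (fun s : R^o => u + s *: x) @ (0 : R^o) --> u + (0 : R) *: x.
  apply: tvs_cvgD; first exact: cvg_cst.
  by apply: tvs_cvgZ; [exact: cvg_id|exact: cvg_cst].
rewrite scale0r addr0 => /(_ U (open_nbhs_nbhs (conj oU Uu))).
move=> /nbhs_ballP[e /= e0 eU]; exists (e / 2); first by rewrite divr_gt0.
move=> s se; apply: eU; rewrite -ball_normE/= sub0r normrN.
by apply: le_lt_trans se _; rewrite ltr_pdivrMr// ltr_pMr// ltr1n.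
Qed.

(** The cone generated by [U] extends to a total cone; any point of [U] is an order
    unit because [U] is open, and the functional of the total cone is continuous
    because it is bounded on a neighbourhood of 0. *)
Theorem open_convex_separation (R : realType) (V : tvsType R) (U : set V) :
  open U -> convex_set U -> U !=set0 -> ~ U 0 ->
  exists f : clin V R^o, forall u, U u -> 0 < f u.
Proof.
move=> oU /convex_setP cU [u0 Uu0] U0.
have [M [coneM UM totM]] : exists M, [/\ blunt_cone M, U `<=` M &
    forall x, x != 0 -> M x \/ M (- x)].
  pose CU := [set z | exists2 t, 0 < t & exists2 u, U u & z = t *: u].
  have UCU : U `<=` CU by move=> u Uu; exists 1 => //; exists u; rewrite ?scale1r.
  have : blunt_cone CU.
    split.
    - move=> _ _ [t t0 [u Uu ->]] [s s0 [v Uv ->]].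
      have ts0 : 0 < t + s by exact: addr_gt0.
      exists (t + s) => //; exists (t / (t + s) *: u + (1 - t / (t + s)) *: v).
        apply: cU => //; first by rewrite divr_ge0// ltW.
        by rewrite ler_pdivrMr// mul1r lerDl ltW.
      rewrite scalerDr !scalerA mulrBr mulr1 mulrCA divff ?gt_eqF// mulr1.
      by rewrite [t + s - t]addrC addKr.
    - move=> t _ t0 [s s0 [u Uu ->]]; exists (t * s); first exact: mulr_gt0.
      by exists u; rewrite ?scalerA.
    - move=> [t t0 [u Uu /esym/eqP]]; rewrite scaler_eq0 gt_eqF//= => /eqP uE.
      by apply: U0; rewrite -uE.
  move=> /blunt_cone_maximal[M [? CUM ?]]; exists M; split=> //.
  exact: subset_trans CUM.
have [Ma Ms M0] := coneM.
have unitM x : exists t, M (t *: u0 - x).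
  have [e e0 Ue] := open_absorbing x oU Uu0; exists e^-1.
  have -> : e^-1 *: u0 - x = e^-1 *: (u0 + (- e) *: x).
    by rewrite scalerDr scalerA mulrN mulVf ?gt_eqF// scaleN1r.
  apply: Ms; first by rewrite invr_gt0.
  by apply: UM; apply: Ue; rewrite normrN gtr0_norm.
have [f [flin f_ge f_le]] := total_cone_functional coneM (UM _ Uu0) totM unitM.
have fB x y : f (x - y) = f x - f y.
  by rewrite -scaleN1r addrC flin scaleN1r addrC.
have fcont : continuous f.
  move=> x; apply/cvgrPdist_le => /= e e0.
  have near_u0 c : \forall y \near x, U (u0 + c *: (y - x)).
    have : (fun y => u0 + c *: (y - x)) @ x --> u0 + c *: (x - x).
      apply: tvs_cvgD; first exact: cvg_cst.
      apply: tvs_cvgZ; first exact: cvg_cst.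
      by apply: tvs_cvgB; [exact: cvg_id|exact: cvg_cst].
    by rewrite subrr scaler0 addr0; apply; exact: open_nbhs_nbhs.
  near=> y.
  have MeD c : `|c| = 1 -> U (u0 + (c / e) *: (y - x)) ->
      M (e *: u0 + c *: (y - x)).
    move=> c1 /UM /(Ms e _ e0).
    by rewrite scalerDr scalerA mulrCA divff ?gt_eqF// mulr1.
  rewrite -fB ler_norml; apply/andP; split.
    apply: f_ge; have := MeD (- 1); rewrite normrN1 => /(_ erefl).
    rewrite scaleN1r opprB scaleNr opprK [e *: u0 + _]addrC; apply.
    by near: y; exact: near_u0.
  apply: f_le; have := MeD 1; rewrite normr1 => /(_ erefl).
  rewrite scale1r opprB; apply.
  by near: y; exact: near_u0.
have flc : f \in @lincont R V R^o by apply/asboolP.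
exists (Clin flc) => u Uu /=.
have [e e0 Ue] := open_absorbing u0 oU Uu.
apply: (lt_le_trans e0); apply: f_ge; apply: UM.
by rewrite -scaleNr; apply: Ue; rewrite normrN gtr0_norm.
Unshelve. all: by end_near. Qed.

(** * Separation of points from closed convex sets *)

Lemma clin_exists (R : realType) (X Y : tvsType R) (f : X -> Y) :
  linear f -> continuous f -> exists g : clin X Y, forall x, g x = f x.
Proof.
move=> lf cf; have fP : f \in @lincont R X Y by apply/asboolP.
by exists (Clin fP).
Qed.

Section ClinTheory.
Variables (R : realType) (X Y : tvsType R) (f : clin X Y).

Lemma clinD x y : f (x + y) = f x + f y.
Proof. by have [/(_ 1 x y)] := lincontP f; rewrite !scale1r. Qed.

Lemma clin0 : f 0 = 0.
Proof. by apply: (addIr (f 0)); rewrite -clinD !add0r. Qed.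

Lemma clinZ a x : f (a *: x) = a *: f x.
Proof. by have [/(_ a x 0)] := lincontP f; rewrite clin0 !addr0. Qed.

Lemma clinN x : f (- x) = - f x.
Proof. by rewrite -scaleN1r clinZ scaleN1r. Qed.

Lemma clinB x y : f (x - y) = f x - f y.
Proof. by rewrite clinD clinN. Qed.

Lemma clin_continuous : continuous f.
Proof. by have [] := lincontP f. Qed.

End ClinTheory.

Lemma conv_sub (R : realType) (V : lmodType R) (t : R) (x y u v : V) :
  t *: (x - u) + (1 - t) *: (y - v) =
  t *: x + (1 - t) *: y - (t *: u + (1 - t) *: v).
Proof. by rewrite !scalerBr opprD addrACA. Qed.

Lemma conv_id (R : realType) (V : lmodType R) (t : R) (x : V) :
  t *: x + (1 - t) *: x = x.
Proof. by rewrite -scalerDl subrKC scale1r. Qed.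

Section ClosedConvexSeparation.
Variables (R : realType) (V : tvsType R).
Implicit Types (A : set V) (x p : V).

Lemma tvs_convex_nbhs p (N : set V) : nbhs p N ->
  exists U, [/\ open U, convex_set U, U p & U `<=` N].
Proof.
have [B Bconv [Bopen Bbase]] := @locally_convex R V.
move=> /Bbase[U [BU Up] UN]; exists U; split=> //; first exact: Bopen.
by apply: Bconv; exact/mem_set.
Qed.

(** Thicken [A] by a convex neighbourhood of 0 small enough to stay away from [p],
    and separate 0 from the resulting open set translated by [- p]. *)
Lemma closed_convex_separation A p : closed A -> convex_set A -> A !=set0 ->
  ~ A p -> exists f : clin V R^o, forall a, A a -> f p < f a.
Proof.
move=> cA /convex_setP convA [a0 Aa0] Ap.
have : nbhs (0 : V) [set v | ~ A (p - v)].
  have pv : (fun v => p - v) @ (0 : V) --> p.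
    rewrite -[X in _ --> X]subr0.
    by apply: tvs_cvgB; [exact: cvg_cst|exact: cvg_id].
  have Ap' : nbhs p (~` A) by apply: open_nbhs_nbhs; split=> //; rewrite openC.
  exact: (pv _ Ap').
move=> /tvs_convex_nbhs[N [oN /convex_setP convN N0 NA]].
pose U := [set w | exists2 a, A a & N (w - (a - p))].
have oU : open U.
  rewrite openE => w [a Aa Nw].
  have wN : (fun v => v - (a - p)) @ w --> w - (a - p).
    by apply: tvs_cvgB; [exact: cvg_id|exact: cvg_cst].
  have nearN : \forall v \near w, N (v - (a - p)) :=
    wN N (open_nbhs_nbhs (conj oN Nw)).
  by apply: filterS nearN => v Nv; exists a.
have convU : convex_set U.
  apply/convex_setP => w v t t0 t1 [a Aa Nw] [b Ab Nv].
  exists (t *: a + (1 - t) *: b); first exact: convA.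
  have -> : t *: w + (1 - t) *: v - (t *: a + (1 - t) *: b - p) =
      t *: (w - (a - p)) + (1 - t) *: (v - (b - p)).
    by rewrite !conv_sub conv_id.
  exact: convN.
have U_p a : A a -> U (a - p) by move=> Aa; exists a; rewrite ?subrr.
have U0 : ~ U 0.
  by move=> [a Aa]; rewrite sub0r opprB => /NA; rewrite /= subKr.
have [f fU] := open_convex_separation oU convU (ex_intro _ _ (U_p _ Aa0)) U0.
by exists f => a /U_p/fU; rewrite clinB subr_gt0.
Qed.

(** A sum of segments serves as a compact convex neighbourhood of 0 in the span
    of [xs]: its support function is explicit, and closedness and convexity of the
    Minkowski sum follow by adding one segment at a time. *)
Definition add_segments (c : R) (xs : seq V) A : set V :=
  foldr (fun x B => [set w | exists2 t, `|t| <= c & B (w - t *: x)]) A xs.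

Lemma add_segments_convex c xs A : convex_set A -> convex_set (add_segments c xs A).
Proof.
move=> convA; elim: xs => [//|x xs /convex_setP IH] /=.
apply/convex_setP => v w t t0 t1 [a ac va] [b bc wb].
exists (t * a + (1 - t) * b).
  have t1' : 0 <= 1 - t by rewrite subr_ge0.
  apply: le_trans (ler_normD _ _) _.
  rewrite !normrM (ger0_norm t0) (ger0_norm t1').
  have -> : c = t * c + (1 - t) * c by ring.
  by apply: lerD; exact: ler_wpM2l.
rewrite (scalerDl x) -!scalerA -conv_sub.
exact: IH.
Qed.

(** The sum of a closed set and a compact segment is closed: near a point outside
    the sum, all translates by the segment avoid the set uniformly. *)
Lemma add_segments_closed c xs A : closed A -> closed (add_segments c xs A).
Proof.
move=> cA; elim: xs => [//|x xs /=]; move: (add_segments c xs A) => B cB.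
rewrite -openC openE => w Bw.
have := @segment_compact R (- c) c => /compact_near_coveringP.
move=> /(_ V (nbhs w) (fun v t => ~ B (v - t *: x)) _) near_seg.
have nearB : \forall v \near w, `[- c, c]%classic `<=` (fun t => ~ B (v - t *: x)).
  apply: near_seg => t; rewrite /= in_itv/= -ler_norml => tc.
  have cvB : (fun u : R^o * V => u.2 - u.1 *: x) @ (t, w) --> w - t *: x.
    apply: tvs_cvgB; first exact: cvg_snd.
    by apply: tvs_cvgZ; [exact: cvg_fst|exact: cvg_cst].
  have : nbhs (w - t *: x) (~` B).
    apply: open_nbhs_nbhs; split; first by rewrite openC.
    by move=> Bwt; apply: Bw; exists t.
  exact: cvB.
apply: filterS nearB => v vB [t tc]; apply: vB.
by rewrite /= in_itv/= -ler_norml.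
Qed.

Lemma add_segments_ind c xs A (P : set V) : A `<=` P ->
  (forall x t w, x \in xs -> P (w - t *: x) -> P w) -> add_segments c xs A `<=` P.
Proof.
move=> AP; elim: xs => [//|x xs IH] /= xsP w [t _ Bw].
apply: (xsP x t); rewrite ?mem_head//; apply: IH Bw => y s v yxs.
by apply: xsP; rewrite in_cons yxs orbT.
Qed.

(** On the segment of [x] the functional [f] attains its minimum [- c * `|f x|] at an
    end point. *)
Lemma add_segments_lbound c xs A (f : clin V R^o) m : 0 <= c ->
  (forall w, add_segments c xs A w -> m < f w) ->
  forall a, A a -> m + c * \sum_(x <- xs) `|f x| < f a.
Proof.
move=> c0; elim: xs m => [|x xs IH] m /= Hm a Aa.
  by rewrite big_nil mulr0 addr0; exact: Hm.
rewrite big_cons mulrDr addrA; apply: IH Aa => w Bw.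
have := Hm (w - (c * Num.sg (f x)) *: x); rewrite clinB clinZ ltrBrDr.
rewrite -[_ *: f x]/(_ * f x) -mulrA -normrEsg; apply.
exists (- (c * Num.sg (f x))); last by rewrite scaleNr opprK subrK.
rewrite normrN normrM (ger0_norm c0) ler_piMr// normr_sg.
by case: eqP.
Qed.

End ClosedConvexSeparation.

(** * Approximate multipliers of a scalar convex problem *)

Lemma continuous_pair (T U V : topologicalType) (f : T -> U) (g : T -> V) :
  continuous f -> continuous g -> continuous (fun x => (f x, g x)).
Proof. by move=> cf cg x; exact: cvg_pair (cf x) (cg x). Qed.

Lemma clin_partial (R : realType) (X Y W : tvsType R) (j : X -> Y) (f : clin Y W) :
  linear j -> continuous j -> exists g : clin X W, forall x, g x = f (j x).
Proof.
move=> lj cj; apply: clin_exists => [a x y|x].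
  by rewrite lj clinD clinZ.
apply: (@continuous_comp _ _ _ j f); first exact: cj.
exact: clin_continuous.
Qed.

Section ApproximateMultiplier.
Variables (R : realType) (X Z : tvsType R).

Lemma clin_triple (f : clin (X * Z * R^o)%type R^o) :
  exists (u : clin X R^o) (v : clin Z R^o) (rho : R),
    forall x z r, f (x, z, r) = u x + v z + rho * r.
Proof.
have [u uE] : exists u : clin X R^o, forall x, u x = f (x, 0, 0).
  apply: (@clin_partial _ _ _ _ (fun x => (x, 0, 0) : X * Z * R^o)).
    by move=> a x y; congr (_, _, _); rewrite /= scaler0 addr0.
  apply: continuous_pair; last exact: cst_continuous.
  by apply: continuous_pair => x; [exact: cvg_id|exact: cvg_cst].
have [v vE] : exists v : clin Z R^o, forall z, v z = f (0, z, 0).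
  apply: (@clin_partial _ _ _ _ (fun z => (0, z, 0) : X * Z * R^o)).
    by move=> a x y; congr (_, _, _); rewrite /= scaler0 addr0.
  apply: continuous_pair; last exact: cst_continuous.
  by apply: continuous_pair => x; [exact: cvg_cst|exact: cvg_id].
exists u, v, (f (0, 0, 1)) => x z r; rewrite uE vE mulrC.
rewrite -[r * _]/(r *: f (0, 0, 1)) -clinZ -!clinD; congr (f _).
congr (_, _, _) => /=; rewrite ?addr0 ?add0r ?scaler0 ?addr0 //.
by rewrite -[LHS]mulr1.
Qed.

(** The point [(0, 0, alpha - e)] is separated from the sum of [W] and of the
    segments [[- 2, 2] x_i], with [x0] among the [x_i]: by minimality of [alpha]
    no point [(x, 0, alpha - e)] belongs to [W].  Let [mu] be the sum of the
    [`|u x_i|].  Applied at [(x0, 0, alpha)], the separation gives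
    [2 mu < rho e + u x0 <= rho e + mu], where [rho] is the coefficient of the last
    coordinate.  So [rho] is positive, and dividing by it makes every [`|u x_i|]
    smaller than [e].  The factor 2 is what absorbs the term [u x0]. *)
Theorem approximate_multiplier (W : set (X * Z * R^o)) (x0 : X) (alpha : R)
    (xs : seq X) (e : R) :
  closed W -> convex_set W -> W (x0, 0, alpha) ->
  (forall x r, W (x, 0, r) -> alpha <= r) -> 0 < e ->
  exists (u : clin X R^o) (v : clin Z R^o),
    (forall x, x \in xs -> `|u x| < e) /\
    (forall x z r, W (x, z, r) -> alpha - e <= u x + v z + r).
Proof.
move=> cW convW W0 Wmin e0.
pose ys : seq (X * Z * R^o) := [seq (x, 0, 0) | x <- x0 :: xs].
pose W' := add_segments 2 ys W.
have W'p : ~ W' (0, 0, alpha - e).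
  have W'P : W' `<=` [set w | exists x, W (x, w.1.2, w.2)].
    apply: add_segments_ind => [[[x z] r] Ww|_ t [[x z] r] /mapP[y _ ->] /=].
      by exists x.
    by rewrite !scaler0 !subr0.
  by move=> /W'P[x /= /Wmin]; rewrite lerBrDr gerDl leNgt e0.
have subW : W `<=` W'.
  rewrite /W' => w; move: ys {W' W'p} => ys; elim: ys => [//|y ys IH] /= /IH Ww.
  by exists 0; rewrite ?normr0// scale0r subr0.
have [f fW'] := closed_convex_separation (add_segments_closed (c:=2) (xs:=ys) cW)
  (add_segments_convex (c:=2) (xs:=ys) convW) (ex_intro _ _ (subW _ W0)) W'p.
have {fW'} := add_segments_lbound _ fW'.
have [u [v [rho fE]]] := clin_triple f.
rewrite fE !clin0 !add0r big_map => /(_ (ler0n _ _)).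
have -> : \sum_(j <- x0 :: xs) `|f (j, 0, 0)| = \sum_(x <- x0 :: xs) `|u x|.
  by apply: eq_bigr => x _; rewrite fE clin0 mulr0 !addr0.
set mu := \sum_(x <- _) _ => Hf.
have u_mu x : x \in x0 :: xs -> `|u x| <= mu.
  move=> xxs; rewrite /mu (big_rem x xxs)/= lerDl.
  by apply: sumr_ge0.
have u0 := u_mu x0 (mem_head _ _).
have := Hf _ W0; rewrite fE clin0 addr0 => Hx0.
have u0N : u x0 <= `|u x0| by exact: ler_norm.
have abs0 : 0 <= `|u x0| by [].
have mu_lt : mu < rho * e by move: Hx0; rewrite mulrBr; lra.
have rho_gt0 : 0 < rho by rewrite -(pmulr_lgt0 _ e0); lra.
have scale_clin (T : tvsType R) (g : clin T R^o) :
    exists g' : clin T R^o, forall x, g' x = rho^-1 * g x.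
  by exists (rho^-1 *: g).
have [u' u'E] := scale_clin _ u; have [v' v'E] := scale_clin _ v.
exists u', v'; split.
  move=> x xxs; rewrite u'E normrM gtr0_norm ?invr_gt0// mulrC ltr_pdivrMr//.
  by rewrite mulrC; apply: le_lt_trans mu_lt; apply: u_mu; rewrite in_cons xxs orbT.
move=> x z r /Hf; rewrite fE => Hw; rewrite u'E v'E.
rewrite -(ler_pM2l rho_gt0) !mulrDr !mulrA mulfV ?gt_eqF// !mul1r.
have mu0 : 0 <= mu by apply: le_trans u0.
by move: Hw; rewrite mulrDr; lra.
Qed.

End ApproximateMultiplier.

Lemma bounded_below_slope_ge0 (R : realType) (a b c : R) :
  (forall t, 0 < t -> c <= a + t * b) -> 0 <= b.
Proof.
move=> H; rewrite leNgt; apply/negP => b0.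
have d0 : 0 < `|a - c| + 1 by rewrite ltr_wpDl.
have := H ((`|a - c| + 1) / - b); rewrite divr_gt0 ?oppr_gt0// => /(_ erefl).
rewrite invrN mulrN mulNr mulfVK ?lt_eqF//.
by have := ler_norm (a - c); lra.
Qed.

(** * Interior of a convex cone and weak suprema *)

Section ConvexConeInterior.
Variables (R : realType) (Y : tvsType R) (K : set Y).
Hypotheses (K_convex : convex_set K) (K_cone : cone K).

Lemma cone_add x y : K x -> K y -> K (x + y).
Proof.
move=> Kx Ky; have half0 : 0 <= 2^-1 :> R by [].
have half1 : 2^-1 <= 1 :> R by rewrite invf_le1// ler1n.
have /convex_setP/(_ x y 2^-1 half0 half1 Kx Ky) := K_convex.
move=> /(K_cone (ler0n _ 2)); rewrite scalerDr !scalerA mulrBr mulfV//.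
by rewrite (_ : 2 * 1 - 1 = 1) ?scale1r//; ring.
Qed.

Lemma interior_cone_add x y : K° x -> K y -> K° (x + y).
Proof.
move=> Kx Ky.
have cv : (fun v => v - y) @ (x + y) --> x.
  rewrite -[X in _ --> X](addrK y).
  by apply: tvs_cvgB; [exact: cvg_id|exact: cvg_cst].
have nearK : \forall v \near x + y, K (v - y) := cv K Kx.
apply: filterS nearK => v Kv.
by rewrite -(subrK y v); exact: cone_add.
Qed.

Lemma interior_cone_scale t x : 0 < t -> K° x -> K° (t *: x).
Proof.
move=> t0 Kx.
have cv : (fun v => t^-1 *: v) @ (t *: x) --> x.
  rewrite -[X in _ --> X](scalerK (lt0r_neq0 t0)).
  by apply: tvs_cvgZ; [exact: cvg_cst|exact: cvg_id].
have nearK : \forall v \near t *: x, K (t^-1 *: v) := cv K Kx.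
apply: filterS nearK => v Kv.
by rewrite -(scalerKV (lt0r_neq0 t0) v); apply: K_cone => //; exact: ltW.
Qed.

Lemma interior_cone_sub k0 x : K° k0 -> K° x ->
  exists2 e, 0 < e & K° (x - e *: k0).
Proof.
move=> Kk0 Kx; have [e e0 Ke] := open_absorbing k0 (@open_interior _ K) Kx.
by exists e => //; rewrite -scaleNr; apply: Ke; rewrite normrN gtr0_norm.
Qed.

Lemma interior_cone_absorb k0 x : K° k0 ->
  exists2 n, 0 < n & K° (n *: k0 + x).
Proof.
move=> Kk0; have [e e0 Ke] := open_absorbing x (@open_interior _ K) Kk0.
exists e^-1; first by rewrite invr_gt0.
have -> : e^-1 *: k0 + x = e^-1 *: (k0 + e *: x).
  by rewrite scalerDr scalerA mulVf ?scale1r// gt_eqF.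
apply: interior_cone_scale; first by rewrite invr_gt0.
by apply: Ke; rewrite gtr0_norm.
Qed.

Lemma ltK_fin (x y : Y) : ltK K x%:E y%:E <-> K° (y - x).
Proof.
split=> [[k Kk kE]|Kxy]; first by rewrite -opprB -kE opprK.
by exists (y - x); rewrite ?opprB.
Qed.

End ConvexConeInterior.

Section WeakSupremum.
Variables (R : realType) (Y : tvsType R) (K : set Y).
Hypotheses (K_convex : convex_set K) (K_cone : cone K).
Variables (k0 : Y) (Kk0 : K° k0).
Implicit Types (M : set (\bar Y)).

(** The finite weak suprema of [M] are the boundary points of this lower set. *)
Definition below M : set Y := [set u | exists2 v, M v & ltK K u%:E v].

Lemma ltK_addl (x k : Y) v : K k -> ltK K (x + k)%:E v -> ltK K x%:E v.
Proof.
case: v => [y| |//] Kk //; rewrite !ltK_fin opprD addrA => Kxy.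
by rewrite -(subrK k (y - x)); exact: interior_cone_add.
Qed.

Lemma below_sub M u k : below M u -> K k -> below M (u - k).
Proof.
move=> [v Mv uv] Kk; exists v => //; apply: (@ltK_addl _ k) => //.
by rewrite subrK.
Qed.

Lemma below_lt M u v : K° (v - u) -> below M v -> below M u.
Proof.
move=> /interior_subset Kuv /below_sub/(_ Kuv); by rewrite subKr.
Qed.

Lemma below_gt M u : below M u -> exists2 e, 0 < e & below M (u + e *: k0).
Proof.
move=> [[v| |//] Mv uv]; last by exists 1 => //; exists +oo%E.
move/ltK_fin: uv => /(interior_cone_sub Kk0)[e e0 Ke].
by exists e => //; exists v%:E => //; apply/ltK_fin; rewrite opprD addrA.
Qed.

Lemma WSup_below M u v : WSup K M v -> ltK K u%:E v -> below M u.
Proof. by move=> [_ Mv] /Mv. Qed.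

Lemma WSup_nbelow M v : WSup K M v%:E -> ~ below M v.
Proof. by move=> [Mv _] [w /Mv]. Qed.

(** An infinite weak supremum occurs only for an empty or a cofinal [below M]. *)
Lemma WSup_fin M a b v : below M a -> ~ below M b -> WSup K M v ->
  exists y, v = y%:E.
Proof.
case: v => [y|Ma Mb| [w Mw aw] Mb [Mv _]]; first by exists y.
- by move=> /WSup_below/(_ I).
- by case: w aw Mw => [w _|_|//] /Mv /(_ I).
Qed.

(** The parameters [t] with [w + t *: k0] below [M] form a half-line; openness of
    [below M] puts its end point in the weak supremum. *)
Lemma WSup_line M a b w : below M a -> ~ below M b ->
  exists t, WSup K M (w + t *: k0)%:E.
Proof.
move=> Ma Mb.
pose T : set R := [set t | below M (w + t *: k0)].
have supT : has_sup T.
  split.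
    have [n n0 Kn] := interior_cone_absorb K_cone (a - w) Kk0; exists (- n).
    by apply: below_lt Ma; rewrite scaleNr opprD opprK addrA addrC addrA -addrA.
  have [n n0 Kn] := interior_cone_absorb K_cone (w - b) Kk0; exists n => t Tt.
  rewrite leNgt; apply/negP => nt; apply: Mb; apply: below_lt Tt.
  have -> : w + t *: k0 - b = n *: k0 + (w - b) + (t - n) *: k0.
    by rewrite [RHS]addrAC -scalerDl subrKC [RHS]addrC addrAC.
  apply: interior_cone_add => //; apply: K_cone; first by rewrite subr_ge0 ltW.
  exact: interior_subset.
exists (sup T); split.
- move=> v Mv wv.
  have [e e0] : exists2 e, 0 < e & below M (w + sup T *: k0 + e *: k0).
    by apply: below_gt; exists v.
  rewrite -addrA -scalerDl => Te.
  have := sup_ubound (proj2 supT) Te; by rewrite gerDl leNgt e0.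
- move=> [u|//|_]; last first.
    by have [[v| |//] Mv _] := Ma; [exists v%:E|exists +oo%E].
  move=> /ltK_fin/(interior_cone_sub Kk0)[e e0 Ke].
  have [t Tt te] := sup_adherent e0 supT.
  suff [v] : below M u by exists v.
  apply: below_lt Tt.
  have -> : w + t *: k0 - u =
      w + sup T *: k0 - u - e *: k0 + (t - (sup T - e)) *: k0.
    rewrite -[in LHS](subrKC (sup T - e) t) scalerDl scalerBl !addrA.
    by rewrite [LHS]addrAC; congr (_ + _); rewrite [LHS]addrAC.
  apply: interior_cone_add => //; apply: K_cone; first by rewrite subr_ge0 ltW.
  exact: interior_subset.
Qed.

Lemma below_WSup M q a b : below M a -> ~ below M b ->
  below M q <-> exists2 v, WSup K M v%:E & K° (v - q).
Proof.
move=> Ma Mb; split; last first.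
  by move=> [v Mv /ltK_fin]; exact: WSup_below.
move=> Mq; have [t Mt] := WSup_line q Ma Mb.
exists (q + t *: k0) => //; rewrite addrC addKr.
apply: interior_cone_scale => //; rewrite ltNge; apply/negP => t0.
apply: (WSup_nbelow Mt); rewrite -(opprK t) scaleNr.
apply: below_sub => //; apply: K_cone; first by rewrite oppr_ge0.
exact: interior_subset.
Qed.

Lemma WSup_above M u a b : below M a -> ~ below M b -> M u%:E ->
  exists2 t, 0 <= t & WSup K M (u + t *: k0)%:E.
Proof.
move=> Ma Mb Mu; have [t Mt] := WSup_line u Ma Mb; exists t => //.
rewrite leNgt; apply/negP => t0; apply: (WSup_nbelow Mt); exists u%:E => //.
apply/ltK_fin; rewrite opprD addNKr -scaleNr.
by apply: interior_cone_scale => //; rewrite oppr_gt0.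
Qed.

(** From a point outside [below M], going down along [k0] meets the weak supremum. *)
Lemma addK_WSup M w a : below M a ->
  addK K (WSup K M) w%:E <-> ~ below M w.
Proof.
move=> Ma; split.
  move=> [[m| |] Mm [k Kk]]//= [wE] [v Mv wv]; apply: (WSup_nbelow Mm).
  by exists v => //; apply: (@ltK_addl _ k) => //; rewrite wE.
move=> Mw; have [t Mt] := WSup_line w Ma Mw.
exists (w + t *: k0)%:E => //; exists (- t *: k0).
  apply: K_cone; last exact: interior_subset.
  rewrite oppr_ge0 leNgt; apply/negP => t0; apply: Mw.
  apply/(below_WSup w Ma (WSup_nbelow Mt)); exists (w + t *: k0) => //.
  by rewrite addrC addKr; exact: interior_cone_scale.
by rewrite -[LHS]/((w + t *: k0 + - t *: k0)%:E) scaleNr addrK.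
Qed.

End WeakSupremum.

(** * Conjugates of the Lagrangian *)

Section Lagrangian.
Variables (R : realType) (X Y Z : tvsType R) (K : set Y) (S : set Z).
Variables (C : set X) (F : X -> \bar Y) (G : X -> \bar Z).
Hypotheses (K_convex : convex_set K) (K_cone : cone K).
Variables (k0 : Y) (Kk0 : K° k0).
Hypotheses (S_neq0 : S !=set0) (S_cone : cone S).
Hypotheses (F_proper : eproper F) (G_proper : eproper G).
Implicit Types (T : clin Z Y) (L : clin X Y).

Lemma cone0 : S 0.
Proof. by have [s Ss] := S_neq0; rewrite -(scale0r s); exact: S_cone. Qed.

Lemma eproper_fin (V : tvsType R) (H : X -> \bar V) x :
  eproper H -> H x = +oo%E \/ exists y, H x = y%:E.
Proof.
move=> [_ HN]; case Hx : (H x) => [y| |]; [by right; exists y|by left|].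
by exfalso; apply: HN; exists x.
Qed.

Definition indic_values T : set (\bar Y) :=
  [set ((T z)%:E - Defs.indic Y (-%R @` S) z)%E | z in [set: Z]].

Definition lagrangian_values T L : set (\bar Y) :=
  [set ((L x)%:E - lagrangian C F G T x)%E | x in [set: X]].

Lemma below_indic T u :
  below K (indic_values T) u <-> exists2 s, S s & K° (- T s - u).
Proof.
split.
  move=> [_ [z _ <-]]; rewrite /Defs.indic; case: asboolP => [[s Ss <-]|//].
  rewrite -[X in ltK _ _ X]/((T (- s) - 0)%:E) subr0 clinN => /ltK_fin Ks.
  by exists s.
move=> [s Ss Ks]; exists (- T s)%:E; last exact/ltK_fin.
exists (- s) => //; rewrite /Defs.indic asboolT; last by exists s.
by rewrite -[LHS]/((T (- s) - 0)%:E) subr0 clinN.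
Qed.

Lemma below_lagrangian T L u : below K (lagrangian_values T L) u <->
  exists x f z, [/\ C x, F x = f%:E, G x = z%:E & K° (L x - (f + T z) - u)].
Proof.
have fin x f z : C x -> F x = f%:E -> G x = z%:E ->
    ((L x)%:E - lagrangian C F G T x)%E = (L x - (f + T z))%:E.
  move=> Cx Fx Gx; rewrite /lagrangian Fx Gx /Defs.indic asboolT//.
  by rewrite -[LHS]/((L x - (f + 0 + T z))%:E) addr0.
split.
  move=> [_ [x _ <-]].
  have [Fx|[f Fx]] := eproper_fin x F_proper;
    have [Gx|[z Gx]] := eproper_fin x G_proper;
    try by rewrite /lagrangian Fx Gx /Defs.indic; case: asboolP.
  have [Cx|nCx] := pselect (C x).
    by rewrite (fin _ _ _ Cx Fx Gx) => /ltK_fin Ku; exists x, f, z.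
  by rewrite /lagrangian Fx Gx /Defs.indic asboolF.
move=> [x [f [z [Cx Fx Gx Ku]]]]; exists (L x - (f + T z))%:E; last exact/ltK_fin.
by exists x => //; exact: fin.
Qed.

Section Multiplier.
Variable T : clin Z Y.
Hypothesis LT : Lplusw S K T.

Lemma below_indic_k0 : below K (indic_values T) (- k0).
Proof.
apply/below_indic; exists 0; first exact: cone0.
by rewrite clin0 oppr0 sub0r opprK.
Qed.

(** A point below and a point not below the values make their weak suprema finite;
    the second exists because [T S] avoids [- int K]. *)
Lemma nbelow_indic_k0 : ~ below K (indic_values T) k0.
Proof.
move=> /below_indic[s Ss Ks].
have : ((T @` S) `&` (-%R @` K°)) (T s).
  split; first by exists s.
  exists (- T s); last by rewrite opprK.
  rewrite -(subrK k0 (- T s)); apply: interior_cone_add => //.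
  exact: interior_subset.
by rewrite LT.
Qed.

Lemma indic_conj_fin v : indic_conj K S T v -> exists w, v = w%:E.
Proof. exact: (WSup_fin below_indic_k0 nbelow_indic_k0). Qed.

End Multiplier.

(** The common content of the epigraph condition in [h], of the inclusion in [i]
    and of the exclusion in [j]: [y - v] is an upper bound of the Lagrangian values
    for every finite weak supremum [v] of [T (- S)]. *)
Definition dominates T L y :=
  forall v, indic_conj K S T v%:E -> ~ below K (lagrangian_values T L) (y - v).

Variables (xbar : X) (a : Y).
Hypotheses (feas_xbar : feasible S C G xbar) (Fxbar : F xbar = a%:E).

Lemma below_lagrangian_neq0 T L : exists u, below K (lagrangian_values T L) u.
Proof.
have [Cx [_ [s Ss <-] Gx]] := feas_xbar.
exists (L xbar - (a + T (- s)) - k0); apply/below_lagrangian.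
by exists xbar, a, (- s); split; rewrite ?subKr.
Qed.

Lemma addK_conjugate T L y :
  addK K (conjugate K (lagrangian C F G T) L) y%:E <->
  ~ below K (lagrangian_values T L) y.
Proof.
have [u uP] := below_lagrangian_neq0 T L.
exact: (addK_WSup K_convex K_cone Kk0 y uP).
Qed.

Lemma bigcap_translateP T L y : Lplusw S K T ->
  (\bigcap_(v in indic_conj K S T)
     translate (epi_conjugate K (lagrangian C F G T)) v) (L, y) <->
  dominates T L y.
Proof.
move=> LT; split=> [H v Tv|H v Tv].
  have [[L' y'] /= /addK_conjugate H' [LE yE]] := H _ Tv.
  by rewrite LE yE addr0 addrK.
have [w vE] := indic_conj_fin LT Tv; rewrite vE in Tv *.
exists (L, y - w) => /=; first exact/addK_conjugate/H.
rewrite addr0; congr (_, _).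
by rewrite -[RHS]/((y - w + w)%:E) subrK.
Qed.

Lemma sub_addK_conjugateP T : Lplusw S K T ->
  [set (- F xbar - v)%E | v in indic_conj K S T]
    `<=` addK K (conjugate K (lagrangian C F G T) 0) <->
  dominates T 0 (- a).
Proof.
move=> LT; rewrite Fxbar; split=> [H v Tv|H _ [v Tv <-]].
  by apply/addK_conjugate/H; exists v%:E.
by have [w vE] := indic_conj_fin LT Tv; rewrite vE in Tv *; exact/addK_conjugate/H.
Qed.

(** A value [q = F x + T (G x) - F xbar] lies in [T (- S) - int K] if and only if some
    weak supremum [v] of [T (- S)] satisfies [q < v]; exchanging the two universal
    quantifiers over [x] and [v] gives the equivalence. *)
Lemma notin_imageP T : Lplusw S K T ->
  (forall x, C x ->
    ~ (EFin @` [set t - k | t in T @` (-%R @` S) & k in K°])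
        (F x + er_map T (G x) - F xbar)%E) <->
  dominates T 0 (- a).
Proof.
move=> LT; rewrite Fxbar.
have WSupP q :=
  below_WSup K_convex K_cone Kk0 q (below_indic_k0 T) (nbelow_indic_k0 LT).
have E (f z v : Y) : 0 - (f + z) - (- a - v) = v - (f + z - a).
  by rewrite sub0r !opprB opprK addrC addrA.
split.
- move=> H v Tv /below_lagrangian[x [f [z [Cx Fx Gx]]]].
  rewrite -[(0 : clin X Y) x]/(0 : Y) E => Kv.
  have /below_indic[s Ss Ks] : below K (indic_values T) (f + T z - a).
    by apply/WSupP; exists v.
  apply: (H x Cx); rewrite Fx Gx.
  exists (f + T z - a) => //; exists (T (- s)).
    by exists (- s) => //; exists s.
  by exists (- T s - (f + T z - a)) => //; rewrite clinN subKr.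
- move=> H x Cx [q [_ [_ [s Ss <-] <-] [k Kk qE]]] qF.
  have [Fx|[f Fx]] := eproper_fin x F_proper;
    have [Gx|[z Gx]] := eproper_fin x G_proper;
    try by move: qF; rewrite Fx Gx.
  have {}qF : q = f + T z - a by move: qF; rewrite Fx Gx => -[].
  have /WSupP[v Tv Kv] : below K (indic_values T) q.
    by apply/below_indic; exists s => //; rewrite -qE clinN subKr.
  apply: (H v Tv); apply/below_lagrangian; exists x, f, z; split=> //.
  by rewrite -[(0 : clin X Y) x]/(0 : Y) E -qF.
Qed.

(** The second half of the definition of the weak infimum is automatic at an
    attained value. *)
Lemma weak_solutionP : weak_solution K S C F G xbar <->
  forall x f, feasible S C G x -> F x = f%:E -> ~ K° (a - f).
Proof.
split.
  move=> [_ [_ [H _]]] x f Ax Fx; rewrite -ltK_fin -Fx -Fxbar.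
  by apply: H; exists x.
move=> H; split=> //; split; first by exists xbar.
split=> [_ [x Ax <-]|u au]; last by exists (F xbar) => //; exists xbar.
rewrite Fxbar; have [->//|[f Fx]] := eproper_fin x F_proper.
by rewrite Fx ltK_fin; exact: H Fx.
Qed.

(** Weak duality.  For [x] feasible [T (G x)] is one of the values whose weak supremum
    is [I_{-S}^*(T)], so some [v >= T (G x)] belongs to that supremum, and the upper
    bound [y - v] of the Lagrangian values bounds [L x - F x - T (G x)]. *)
Lemma dominates_feasible T L y x f : Lplusw S K T -> dominates T L y ->
  feasible S C G x -> F x = f%:E -> ~ K° (L x - f - y).
Proof.
move=> LT H [Cx [_ [s Ss <-] /esym Gx]] Fx KL.
have Ts : indic_values T (T (- s))%:E.
  exists (- s) => //; rewrite /Defs.indic asboolT; last by exists s.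
  by rewrite -[LHS]/((T (- s) - 0)%:E) subr0.
have [t t0 Mt] := WSup_above K_convex K_cone Kk0 (below_indic_k0 T)
  (nbelow_indic_k0 LT) Ts.
apply: (H _ Mt); apply/below_lagrangian; exists x, f, (- s); split=> //.
have -> : L x - (f + T (- s)) - (y - (T (- s) + t *: k0)) = L x - f - y + t *: k0.
  by rewrite opprB opprD !addrA subrK addrAC.
apply: interior_cone_add => //; apply: K_cone => //; exact: interior_subset.
Qed.

End Lagrangian.

(** * The topology of pointwise convergence *)

Section PointwiseTopology.
Variables (R : realType) (X Y : tvsType R).

Lemma clin_eval_continuous (x : X) : continuous (fun L : clin X Y => L x).
Proof.
move=> L; apply: (@continuous_comp (clin X Y) {ptws X -> Y} Y
  (fun T : clin X Y => (T : X -> Y)) (fun g : {ptws X -> Y} => g x)).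
  exact: (@initial_continuous (clin X Y) {ptws X -> Y}).
have /pointwise_cvgP : {ptws, nbhs (L : {ptws X -> Y}) --> (L : X -> Y)}.
  exact: cvg_id.
exact.
Qed.

(** The topology on operators is induced by pointwise convergence of functions. *)
Lemma clin_cvgP (T : Type) (Phi : set_system T) (h : T -> clin X Y) (L : clin X Y) :
  Filter Phi -> (forall x, (fun t => h t x) @ Phi --> L x) -> h @ Phi --> L.
Proof.
move=> FPhi hL.
have hptws : {ptws, (fun t => (h t : X -> Y)) @ Phi --> (L : X -> Y)}.
  apply/pointwise_cvgP => x. exact: hL.
move=> U [_ [[W oW <-] /= WL] WU].
have PhiW : Phi [set t | W (h t)] by apply: hptws; exact: open_nbhs_nbhs.
suff: Phi (h @^-1` U) by [].
by apply: filterS PhiW => t; exact: WU.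
Qed.

End PointwiseTopology.

Lemma clin_rank1 (R : realType) (X Y : tvsType R) (u : clin X R^o) (y : Y) :
  exists L : clin X Y, forall x, L x = u x *: y.
Proof.
apply: clin_exists => [b x x'|x].
  by rewrite clinD clinZ scalerDl scalerA.
by apply: tvs_cvgZ; [exact: clin_continuous|exact: cvg_cst].
Qed.

Lemma lsc_epigraph_closed (R : realType) (X : topologicalType) (h : X -> \bar R) :
  lower_semicontinuous h -> closed [set p : X * R^o | (h p.1 <= p.2%:E)%E].
Proof.
move=> lsch; rewrite -openC openE => -[x r] /= /negP; rewrite -ltNge => rh.
have [b rb bh] : exists2 b, r < b & (b%:E < h x)%E.
  case: (h x) rh => [y| |//]; rewrite ?lte_fin => ry.
    by exists ((r + y) / 2); rewrite ?lte_fin; lra.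
  by exists (r + 1); rewrite ?ltry// ltrDl.
have [V Vx Vh] := lsch x b bh.
exists (V, [set s : R^o | s < b]); first split=> //=.
  exact: lt_nbhsl.
move=> [x' r'] [/= Vx' r'b]; apply/negP; rewrite -ltNge.
by apply: (lt_trans _ (Vh _ Vx')); rewrite lte_fin.
Qed.

(** * The asymptotic Farkas lemma *)

Section AsymptoticFarkas.
Variables (R : realType) (X Y Z : tvsType R) (K : set Y) (S : set Z).
Variables (C : set X) (F : X -> \bar Y) (G : X -> \bar Z).
Hypotheses (K_convex : convex_set K) (K_cone : cone K) (K_int : K° !=set0).
Hypotheses (S_neq0 : S !=set0) (S_convex : convex_set S) (S_cone : cone S).
Hypotheses (C_closed : closed C) (C_convex : convex_set C).
Hypotheses (F_proper : eproper F) (F_convex : Kconvex K F)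
  (F_lsc : forall ystar : clin Y R^o,
     lower_semicontinuous (fun x => er_map ystar (F x) : \bar R)).
Hypotheses (G_proper : eproper G) (G_convex : Kconvex S G)
  (G_closed : Kepi_closed S G).
Variables (xbar : X) (a : Y).
Hypotheses (feas_xbar : feasible S C G xbar) (Fxbar : F xbar = a%:E).

Lemma epiP (V : tvsType R) (Q : set V) (H : X -> \bar V) x y :
  epi Q H (x, y) <-> exists h q, [/\ H x = h%:E, Q q & y = h + q].
Proof.
split=> [[_ /= -> [q Qq]]|[h [q [Hx Qq ->]]]].
  by case: (H x) => [h| |]//= [<-]; exists h, q.
by exists (H x) => //; exists q; rewrite ?Hx.
Qed.

Lemma feasibleP x : feasible S C G x <-> C x /\ epi S G (x, 0).
Proof.
split.
  move=> [Cx [_ [s Ss <-] Gx]]; split=> //; apply/epiP; exists (- s), s.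
  by rewrite addNr.
move=> [Cx /epiP[z [s [Gx Ss /eqP]]]]; rewrite eq_sym addr_eq0 => /eqP zE.
by split=> //; exists (- s); [exists s|rewrite Gx zE].
Qed.

Lemma feasible_convex x x' t : 0 <= t -> t <= 1 ->
  feasible S C G x -> feasible S C G x' -> feasible S C G (t *: x + (1 - t) *: x').
Proof.
move=> t0 t1 /feasibleP[Cx Gx] /feasibleP[Cx' Gx']; apply/feasibleP; split.
  by move/convex_setP : C_convex; exact.
have /convex_setP/(_ _ _ _ t0 t1 Gx Gx') := G_convex.
by rewrite -[X in epi S G X]/(t *: x + (1 - t) *: x', t *: 0 + (1 - t) *: 0)
  !scaler0 addr0.
Qed.

Lemma F_combination x x' f f' t : 0 <= t -> t <= 1 ->
  F x = f%:E -> F x' = f'%:E ->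
  exists g k, [/\ F (t *: x + (1 - t) *: x') = g%:E, K k &
    t *: f + (1 - t) *: f' = g + k].
Proof.
move=> t0 t1 Fx Fx'.
have K0 : K 0.
  have [k Kk] := K_int; apply: cone0 => //.
  by exists k; exact: interior_subset.
have /convex_setP/(_ (x, f) (x', f') t t0 t1) := F_convex.
move=> FtP; apply/epiP; apply: FtP; apply/epiP.
  by exists f, 0; rewrite addr0.
by exists f', 0; rewrite addr0.
Qed.

(** Separate 0 from the open convex set [F(A) + int K - F xbar]; scaling the part in
    [int K] towards 0 yields the minimality of [F xbar]. *)
Lemma scalarization :
  (forall x f, feasible S C G x -> F x = f%:E -> ~ K° (a - f)) ->
  exists ystar : clin Y R^o, [/\ forall k, K° k -> 0 < ystar k &
    forall x f, feasible S C G x -> F x = f%:E -> ystar a <= ystar f].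
Proof.
move=> Hmin.
pose U := [set w | exists x f, [/\ feasible S C G x, F x = f%:E & K° (w + a - f)]].
have oU : open U.
  rewrite openE => w [x [f [Ax Fx Kw]]].
  have cv : (fun v => v + a - f) @ w --> w + a - f.
    apply: tvs_cvgB; last exact: cvg_cst.
    by apply: tvs_cvgD; [exact: cvg_id|exact: cvg_cst].
  have nearK : \forall v \near w, K° (v + a - f).
    by apply: cv; apply: open_nbhs_nbhs; split=> //; exact: open_interior.
  by apply: filterS nearK => v Kv; exists x, f.
have convU : convex_set U.
  apply/convex_setP => w v t t0 t1 [x [f [Ax Fx Kw]]] [x' [f' [Ax' Fx' Kv]]].
  have [g [k [Fg Kk gE]]] := F_combination t0 t1 Fx Fx'.
  exists (t *: x + (1 - t) *: x'), g; split=> //; first exact: feasible_convex.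
  have -> : t *: w + (1 - t) *: v + a - g =
      t *: (w + a - f) + (1 - t) *: (v + a - f') + k.
    rewrite !conv_sub gE opprD !addrA subrK.
    by congr (_ - _); rewrite !scalerDr addrACA conv_id.
  apply: interior_cone_add => //.
  have [->|tn0] := eqVneq t 0; first by rewrite scale0r add0r subr0 scale1r.
  apply: interior_cone_add => //.
    by apply: interior_cone_scale => //; rewrite lt_neqAle eq_sym tn0.
  by apply: K_cone; [rewrite subr_ge0|exact: interior_subset].
have U0 : ~ U 0.
  by move=> [x [f [Ax Fx]]]; rewrite add0r; exact: (Hmin _ _ Ax Fx).
have UK k : K° k -> U k by move=> Kk; exists xbar, a; rewrite addrK.
have [ystar yU] : exists ystar : clin Y R^o, forall u, U u -> 0 < ystar u.
  apply: open_convex_separation => //.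
  by have [k Kk] := K_int; exists k; exact: UK.
exists ystar; split; first by move=> k /UK/yU.
move=> x f Ax Fx; have [k Kk] := K_int.
rewrite -subr_ge0; apply/ler_addgt0Pr => e e0.
have yk0 := yU _ (UK _ Kk).
have /yU : U (f - a + (e / ystar k) *: k).
  exists x, f; split=> //.
  rewrite [f - a + _]addrAC subrK addrAC subrr add0r.
  by apply: interior_cone_scale => //; rewrite divr_gt0.
rewrite clinD clinB clinZ -[_ *: ystar k]/(_ * ystar k) mulfVK ?gt_eqF//.
exact: ltW.
Qed.

(** The closed convex set whose section at [z = 0] is the epigraph of the scalarised
    problem. *)
Definition lagrangian_epigraph (ystar : clin Y R^o) : set (X * Z * R^o) :=
  [set w | [/\ C w.1.1, epi S G w.1 & (er_map ystar (F w.1.1) <= w.2%:E)%E]].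

Lemma lagrangian_epigraph_closed ystar : closed (lagrangian_epigraph ystar).
Proof.
have -> : lagrangian_epigraph ystar =
    (fun w => w.1.1) @^-1` C `&` fst @^-1` epi S G `&`
    (fun w => (w.1.1, w.2)) @^-1`
      [set p : X * R^o | (er_map ystar (F p.1) <= p.2%:E)%E].
  by apply/seteqP; split=> [w [? ? ?]|w [[? ?] ?]].
have c1 : continuous (fun w : X * Z * R^o => w.1.1).
  move=> w; apply: (@continuous_comp _ _ _ (@fst (X * Z) R^o) (@fst X Z));
    exact: cvg_fst.
apply: closedI; first apply: closedI.
- by apply: closed_comp => // w _; exact: c1.
- by apply: closed_comp; [move=> w _; exact: cvg_fst|exact: G_closed].
- apply: closed_comp; last exact: (lsc_epigraph_closed (@F_lsc ystar)).
  by move=> w _; apply: continuous_pair => // {}w; exact: cvg_snd.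
Qed.

Lemma lagrangian_epigraphP ystar x z r : lagrangian_epigraph ystar (x, z, r) <->
  exists f, [/\ C x, epi S G (x, z), F x = f%:E & ystar f <= r].
Proof.
split=> [[/= Cx Gx]|[f [Cx Gx Fx fr]]]; last by split; rewrite //= Fx lee_fin.
have [->//|[f Fx]] := eproper_fin x F_proper.
by rewrite Fx lee_fin => fr; exists f.
Qed.

Lemma lagrangian_epigraph_convex (ystar : clin Y R^o) :
  (forall k, K k -> 0 <= ystar k) -> convex_set (lagrangian_epigraph ystar).
Proof.
move=> yK; apply/convex_setP => -[[x z] r] [[x' z'] r'] t t0 t1.
move=> /lagrangian_epigraphP[f [Cx Gx Fx fr]].
move=> /lagrangian_epigraphP[f' [Cx' Gx' Fx' fr']].
have [g [k [Fg Kk gE]]] := F_combination t0 t1 Fx Fx'.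
apply/lagrangian_epigraphP; exists g; split=> //.
- by move/convex_setP : C_convex; exact.
- by have /convex_setP/(_ _ _ _ t0 t1 Gx Gx') := G_convex.
- have := yK _ Kk; rewrite -[k](addKr g) -gE addrC clinB clinD !clinZ subr_ge0.
  move=> /le_trans; apply; apply: lerD; apply: ler_wpM2l => //.
  by rewrite subr_ge0.
Qed.

(** An approximate multiplier [(u, v)] of the scalarised problem becomes a vector
    multiplier by composing with [t |-> t *: k0]. *)
Lemma asymptotic_multiplier :
  (forall x f, feasible S C G x -> F x = f%:E -> ~ K° (a - f)) ->
  exists2 k0, K° k0 & forall (xs : seq X) (e : R), 0 < e ->
  exists T L, [/\ Lplusw S K T, dominates K S C F G T L (e *: k0 - a) &
    forall x, x \in xs -> exists2 t, `|t| < e & L x = t *: k0].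
Proof.
move=> /scalarization[ystar [ypos ymin]].
have [k0 Kk0 yk0] : exists2 k0, K° k0 & ystar k0 = 1.
  have [k Kk] := K_int; exists ((ystar k)^-1 *: k).
    by apply: interior_cone_scale => //; rewrite invr_gt0 ypos.
  by rewrite clinZ -[LHS]/(_ * _) mulVf// gt_eqF// ypos.
have yK k : K k -> 0 <= ystar k.
  move=> Kk; apply/ler_addgt0Pr => e e0.
  have : 0 < ystar (e *: k0 + k).
    by apply: ypos; apply: interior_cone_add => //; exact: interior_cone_scale.
  by rewrite clinD clinZ yk0 -[_ *: 1]/(_ * 1) mulr1 addrC; exact: ltW.
exists k0 => // xs e e0.
have [Cx [_ [s0 Ss0 <-] Gxbar]] := feas_xbar.
have W0 z s : S s -> z = - s0 + s -> lagrangian_epigraph ystar (xbar, z, ystar a).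
  by move=> Ss zE; apply/lagrangian_epigraphP; exists a; split=> //;
    apply/epiP; exists (- s0), s.
have Wmin x r : lagrangian_epigraph ystar (x, 0, r) -> ystar a <= r.
  move=> /lagrangian_epigraphP[f [Cx' Gx Fx]]; apply: le_trans.
  by apply: (ymin x) => //; exact/feasibleP.
have [u [v [u_small uv]]] := approximate_multiplier xs
  (@lagrangian_epigraph_closed ystar)
  (lagrangian_epigraph_convex yK) (W0 0 s0 Ss0 (esym (addNr _))) Wmin e0.
have S_add s s' : S s -> S s' -> S (s + s') by exact: cone_add.
(* The inequality holds along the whole ray of direction [s] in the set. *)
have v_ge0 s : S s -> 0 <= v s.
  move=> Ss; apply: (@bounded_below_slope_ge0 _ (u xbar + ystar a) _ (ystar a - e)).
  move=> t t0; have := uv xbar (t *: s) (ystar a); rewrite clinZ.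
  rewrite -[_ *: v s]/(_ * v s) addrAC; apply.
  apply: (W0 _ (s0 + t *: s)); last by rewrite addKr.
  by apply: S_add => //; apply: S_cone => //; exact: ltW.
have [T TE] := clin_rank1 v k0; have [L LE] := clin_rank1 u (- k0).
have yscale r : ystar (r *: k0) = r by rewrite clinZ yk0 -[LHS]/(_ * _) mulr1.
exists T, L; split.
- apply/seteqP; split=> // _ [[s Ss <-] [k Kk kE]].
  have := ypos k Kk; rewrite -(opprK k) kE clinN TE yscale oppr_gt0 ltNge.
  by rewrite v_ge0.
- move=> w Tw /(below_lagrangian _ _ F_proper G_proper).
  move=> [x [f [z [Cx' Fx Gx /ypos]]]].
  (* [w] is a supremum of values on which [ystar] is nonpositive. *)
  have yw : ystar w <= 0.
    rewrite leNgt; apply/negP => yw.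
    have d0 : 0 < ystar w / 2 by rewrite divr_gt0.
    have : ltK K (w - (ystar w / 2) *: k0)%:E w%:E.
      by apply/ltK_fin; rewrite subKr; exact: interior_cone_scale.
    move=> /(WSup_below Tw)/below_indic[s Ss /ypos].
    rewrite clinB clinN clinB TE !yscale; have := v_ge0 s Ss; lra.
  have := uv x z (ystar f); rewrite LE TE scalerN.
  have Wx : lagrangian_epigraph ystar (x, z, ystar f).
    apply/lagrangian_epigraphP; exists f; split=> //; apply/epiP; exists z, 0.
    by split; rewrite ?addr0//; exact: cone0.
  move=> /(_ Wx); rewrite !(clinB, clinD, clinN, yscale); lra.
- move=> x /u_small ux; exists (- u x); first by rewrite normrN.
  by rewrite LE scalerN scaleNr.
Qed.

End AsymptoticFarkas.

(** * Closures in the space of operators *)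

(** The complement of [int K] is closed and evaluation at [x] is continuous. *)
Lemma closure_not_interior (R : realType) (X Y : tvsType R) (K : set Y)
    (P : set (clin X Y * Y)) (x : X) (f : Y) L y :
  (forall L' y', P (L', y') -> ~ K° (L' x - f - y')) ->
  closure P (L, y) -> ~ K° (L x - f - y).
Proof.
move=> PK clP KL.
have cv : (fun p : clin X Y * Y => p.1 x - f - p.2) @ (L, y) --> L x - f - y.
  apply: tvs_cvgB; last exact: cvg_snd.
  apply: tvs_cvgB; last exact: cvg_cst.
  have c1 : (fun p : clin X Y * Y => p.1) @ (L, y) --> L by exact: cvg_fst.
  have c2 : (fun L' : clin X Y => L' x) @ L --> L x :=
    @clin_eval_continuous _ _ _ x L.

  exact: (cvg_comp _ _ c1 c2).
have nearK : nbhs (L, y) [set p : clin X Y * Y | K° (p.1 x - f - p.2)].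
  by apply: cv; apply: open_nbhs_nbhs; split=> //; exact: open_interior.
by have [[L' y'] [/PK]] := clP _ nearK.
Qed.

(** The pairs [(xs, e)] index a filter of subsets of [P] along which the operators
    tend to 0 at every point. *)
Lemma closure_rank1 (R : realType) (X Y : tvsType R) (P : set (clin X Y * Y))
    (k0 b : Y) :
  (forall (xs : seq X) (e : R), 0 < e -> exists L, P (L, e *: k0 + b) /\
    forall x, x \in xs -> exists2 t, `|t| < e & L x = t *: k0) ->
  closure P (0, b).
Proof.
move=> HP.
pose Phi := filter_from [set i : seq X * R | 0 < i.2] (fun i =>
  [set p | P p /\ (exists2 t, `|t| < i.2 & p.2 = t *: k0 + b) /\
    forall x, x \in i.1 -> exists2 t, `|t| < i.2 & p.1 x = t *: k0]).
have FPhi : Filter Phi.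
  apply: filter_from_filter; first by exists ([::], 1) => /=.
  move=> [xs e] [xs' e'] /= e0 e'0; exists (xs ++ xs', Num.min e e').
    by rewrite /= lt_min e0.
  move=> p /= [Pp [[t]]]; rewrite lt_min => /andP[te te'] pE px.
  split; split=> //; split; (try by exists t) => x xxs.
    have [|s] := px x; first by rewrite mem_cat xxs.
    by rewrite lt_min => /andP[? _]; exists s.
  have [|s] := px x; first by rewrite mem_cat xxs orbT.
  by rewrite lt_min => /andP[_ ?]; exists s.
have small (N : set Y) (c : Y) : nbhs c N ->
    exists2 e : R, 0 < e & forall t, `|t| < e -> N (t *: k0 + c).
  move=> Nc.
  have cv : (fun t : R^o => t *: k0 + c) @ (0 : R^o) --> c.
    rewrite -[X in _ --> X]add0r -(scale0r k0).
    apply: tvs_cvgD; last exact: cvg_cst.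
    by apply: tvs_cvgZ; [exact: cvg_id|exact: cvg_cst].
  have /nbhs_ballP[e /= e0 eN] := cv _ Nc; exists e => // t te.
  by apply: eN; rewrite -ball_normE/= sub0r normrN.
have Phi1 : fst @ Phi --> (0 : clin X Y).
  apply: clin_cvgP => x N /small[e e0 eN].
  exists ([:: x], e) => // -[L y] /= [_ [_ /(_ x (mem_head _ _))[t te ->]]].
  by rewrite -[t *: k0]addr0; exact: eN.
have Phi2 : snd @ Phi --> b.
  move=> N /small[e e0 eN].
  by exists ([::], e) => // -[L y] /= [_ [[t te ->] _]]; exact: eN.
have Phi_cvg : Phi --> (0 : clin X Y, b).
  move=> N [[A B] /= [A0 Bb] ABN].
  have PhiA : Phi [set p | A p.1] := Phi1 A A0.
  have PhiB : Phi [set p | B p.2] := Phi2 B Bb.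
  have PhiAB := @filterI _ Phi FPhi _ _ PhiA PhiB.
  suff: Phi N by [].
  by apply: filterS PhiAB => p [pA pB]; exact: ABN.
move=> N /Phi_cvg[[xs e] /= e0 eN].
have [L [PL Lxs]] := HP xs (e / 2) (divr_gt0 e0 (ltr0n _ 2)).
have e2 : e / 2 < e by rewrite ltr_pdivrMr// ltr_pMr// ltr1n.
exists (L, (e / 2) *: k0 + b); split=> //; apply: eN => /=; split=> //; split.
  by exists (e / 2) => //; rewrite gtr0_norm// divr_gt0.
by move=> x /Lxs[t te Lx]; exists t => //; exact: lt_trans e2.
Qed.

(** * Equivalence of the three assertions *)

Theorem theorem5p3 (R : realType) (X Y Z : tvsType R)
  (X_hausdorff : hausdorff_space X)
  (Y_hausdorff : hausdorff_space Y)
  (Z_hausdorff : hausdorff_space Z)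
  (K : set Y) (K_closed : closed K) (K_pointed : pointed_cone K)
  (K_convex : convex_set K) (K_cone : cone K) (K_int : K° !=set0)
  (S : set Z) (S_neq0 : S !=set0) (S_closed : closed S)
  (S_convex : convex_set S) (S_cone : cone S)
  (C : set X) (C_neq0 : C !=set0) (C_closed : closed C)
  (C_convex : convex_set C)
  (F : X -> \bar Y) (F_proper : eproper F) (F_convex : Kconvex K F)
  (F_lsc : forall ystar : clin Y R^o,
     lower_semicontinuous (fun x => er_map ystar (F x) : \bar R))
  (G : X -> \bar Z) (G_proper : eproper G) (G_convex : Kconvex S G)
  (G_closed : Kepi_closed S G)
  (xbar : X) (xbar_dom : (feasible S C G `&` edom F) xbar) :
  let h :=
    closed_regarding
      (\bigcup_(T in Lplusw S K)
         \bigcap_(v in indic_conj K S T)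
           translate (epi_conjugate K (lagrangian C F G T)) v)
      [set p : clin X Y * Y | (p.1, p.2%:E) = (0, (- F xbar)%E)] in
  let i :=
    weak_solution K S C F G xbar <->
    exists2 T, Lplusw S K T &
      [set (- F xbar - v)%E | v in indic_conj K S T]
        `<=` addK K (conjugate K (lagrangian C F G T) 0) in
  let j :=
    weak_solution K S C F G xbar <->
    exists2 T, Lplusw S K T &
      forall x, C x ->
        ~ (EFin @` [set t - k | t in T @` (-%R @` S) & k in K°])
            (F x + er_map T (G x) - F xbar)%E in
  (h <-> i) /\ (i <-> j).
Proof.
have [feas_xbar dom_xbar] := xbar_dom.
have [//|[a Fxbar]] := eproper_fin xbar F_proper.
have [k0 Kk0] := K_int.
set P := (X in closed_regarding X _).
pose multiplier := exists2 T, Lplusw S K T & dominates K S C F G T 0 (- a).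
have PP L y : P (L, y) <-> exists2 T, Lplusw S K T & dominates K S C F G T L y.
  have TP T (LT : Lplusw S K T) := bigcap_translateP K_convex K_cone Kk0 S_neq0
    S_cone F_proper G_proper feas_xbar Fxbar L y LT.
  by split=> -[T LT HT]; exists T => //; apply/(TP T LT).
have iE : (exists2 T, Lplusw S K T &
      [set (- F xbar - v)%E | v in indic_conj K S T]
        `<=` addK K (conjugate K (lagrangian C F G T) 0)) <-> multiplier.
  have TP T (LT : Lplusw S K T) := sub_addK_conjugateP K_convex K_cone Kk0 S_neq0
    S_cone F_proper G_proper feas_xbar Fxbar LT.
  by split=> -[T LT HT]; exists T => //; apply/(TP T LT).
have jE : (exists2 T, Lplusw S K T &
      forall x, C x ->
        ~ (EFin @` [set t - k | t in T @` (-%R @` S) & k in K°])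
            (F x + er_map T (G x) - F xbar)%E) <-> multiplier.
  have TP T (LT : Lplusw S K T) := notin_imageP C K_convex K_cone Kk0 S_neq0
    S_cone F_proper G_proper Fxbar LT.
  by split=> -[T LT HT]; exists T => //; apply/(TP T LT).
have clE : closure P (0, - a) <-> weak_solution K S C F G xbar.
  split.
    move=> clP; apply/(weak_solutionP K F_proper feas_xbar Fxbar) => x f Ax Fx.
    have -> : a - f = (0 : clin X Y) x - f - (- a).
      by rewrite opprK -[(0 : clin X Y) x]/(0 : Y) sub0r addrC.
    apply: closure_not_interior clP => L y /PP[T LT domT].
    exact: (dominates_feasible K_convex K_cone Kk0 S_neq0 S_cone F_proper
      G_proper LT domT Ax Fx).
  move=> /(weak_solutionP K F_proper feas_xbar Fxbar) Hmin.
  have [k1 Kk1 Hk1] := asymptotic_multiplier K_convex K_cone K_int S_neq0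
    S_convex S_cone C_closed C_convex F_proper F_convex F_lsc G_proper G_convex
    G_closed feas_xbar Fxbar Hmin.
  apply: (@closure_rank1 _ _ _ _ k1) => xs e e0.
  have [T [L [LT domT Lxs]]] := Hk1 xs e e0.
  by exists L; split=> //; apply/PP; exists T.
have regE : closed_regarding P
      [set p : clin X Y * Y | (p.1, p.2%:E) = (0, (- F xbar)%E)]
    <-> (closure P (0, - a) -> P (0, - a)).
  rewrite Fxbar /closed_regarding; set Q := [set p | _].
  have QE : Q = [set (0, - a)].
    by apply/seteqP; split=> [[L y] [-> ->]|_ ->].
  rewrite QE; split=> [E clP|E].
    have : ([set (0, - a)] `&` closure P) (0, - a) by [].
    by rewrite E => -[].
  apply/seteqP; split=> p [-> Pp]; split=> //; first exact: E.
  exact: subset_closure.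
have multiplier_sol : multiplier -> weak_solution K S C F G xbar.
  by move=> /PP /(@subset_closure _ P) /clE.
split; last by rewrite iE jE.
rewrite iE regE clE; rewrite PP.
by split=> [H|[H _]]; [split|].
Qed.
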